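(* Let $G$ be an $n$-vertex, $K_{r+1}$-free graph where $r \ge 3$. If $G$ is not chorded pancyclic and \[n \ge \begin{cases}26 & \text{if } r=3\\ 11 & \text{if } r=4\\ 4 & \text{if } r \ge 5\end{cases},\] then $e(G) \le e(T_r(n-1))+1$. Equality holds if $G$ is a $T_r(n-1)$ plus a vertex of degree $1$.
   Context: Graphs are simple. $e(G)$ is the number of edges of $G$. $T_r(n)$ is the Turán graph: the $n$-vertex complete $r$-partite graph with parts as balanced as possible (so $T_r(n)=K_n$ if $n\le r$). A graph on $n\ge 4$ vertices is chorded pancyclic if for every $4\le k\le n$ it contains a cycle of length $k$ that has a chord. *)

(* Defs.v *)
From mathcomp Require Import all_boot.

Set Implicit Arguments.
Unset Strict Implicit.
Unset Printing Implicit Defensive.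

Record sgraph := SGraph {
  vertex :> finType;
  adj : rel vertex;
  adj_sym : symmetric adj;
  adj_irrefl : irreflexive adj }.

Definition edges (G : sgraph) : {set {set G}} :=
  [set E : {set G} | [exists x : G, exists y : G,
                        adj x y && (E == [set x; y])]].

Definition num_edges (G : sgraph) : nat := #|edges G|.

Definition degree (G : sgraph) (v : G) : nat := #|[set x : G | adj v x]|.

Definition clique (G : sgraph) (A : {set G}) : Prop :=
  {in A &, forall x y, x != y -> adj x y}.

Definition K_free (k : nat) (G : sgraph) : Prop :=
  ~ exists A : {set G}, clique A /\ #|A| = k.

(* [ucycle] alone would also accept the empty sequence and, since [adj] is
   symmetric, a single edge traversed back and forth. *)
Definition is_cycle (G : sgraph) (c : seq G) : Prop :=
  ucycle (@adj G) c /\ 3 <= size c.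

Definition has_chord (G : sgraph) (c : seq G) : Prop :=
  exists x y : G, [/\ x \in c, y \in c, adj x y,
                      y != next c x & y != prev c x].

Definition chorded_pancyclic (G : sgraph) : Prop :=
  forall k, 4 <= k <= #|G| ->
    exists c : seq G, [/\ is_cycle c, size c = k & has_chord c].

Definition graph_iso (G H : sgraph) : Prop :=
  exists f : G -> H, bijective f /\ forall x y, adj (f x) (f y) = adj x y.

Section Turan.
Variables r n : nat.

(* The parts are the residue classes modulo r; they are balanced by
   [turan_balanced] below. *)
Definition turan_adj : rel 'I_n := fun x y => x %% r != y %% r.

Lemma turan_adj_sym : symmetric turan_adj.
Proof. by move=> x y; rewrite /turan_adj eq_sym. Qed.

Lemma turan_adj_irrefl : irreflexive turan_adj.
Proof. by move=> x; rewrite /turan_adj eqxx. Qed.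

Definition turan : sgraph := SGraph turan_adj_sym turan_adj_irrefl.

Definition turan_part (i : 'I_r) : {set turan} :=
  [set x : 'I_n | x %% r == i].

End Turan.

Lemma card_turan_part r n (i : 'I_r) :
  #|turan_part n i| = n %/ r + (i < n %% r).
Proof.
have r_gt0 : 0 < r := leq_ltn_trans (leq0n i) (ltn_ord i).
rewrite -sum1_card big_mkcond.
rewrite (eq_bigr (fun x : 'I_n => nat_of_bool (x %% r == i))); last first.
  by move=> x _; rewrite inE; case: (x %% r == i).
elim: n => [|n IHn]; first by rewrite big_ord0 div0n mod0n.
rewrite big_ord_recr /= IHn.
have [q [m [-> lt_mr]]] : exists q m, n = q * r + m /\ m < r.
  by exists (n %/ r), (n %% r); rewrite -divn_eq ltn_pmod.
rewrite -addnS !divnMDl // !modnMDl (divn_small lt_mr) (modn_small lt_mr).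
have [lt_m1r | le_rm1] := ltnP m.+1 r.
  rewrite (divn_small lt_m1r) (modn_small lt_m1r) ltnS -addnA; congr (_ + _).
  by case: (ltngtP i m).
have -> : m.+1 = r by apply/eqP; rewrite eqn_leq lt_mr.
rewrite divnn r_gt0 modnn addn0 ltn0 addn0 -addnA; congr (_ + _).
have : i <= m by rewrite -ltnS (leq_trans (ltn_ord i) le_rm1).
by case: (ltngtP i m).
Qed.

Lemma turan_balanced r n (i j : 'I_r) :
  #|turan_part n i| <= #|turan_part n j| + 1.
Proof.
by rewrite !card_turan_part -addnA leq_add2l; case: (i < _); case: (j < _).
Qed.

Section DeleteVertex.
Variables (G : sgraph) (v : G).

Definition del_adj : rel {x : G | x != v} := fun x y => adj (val x) (val y).

Lemma del_adj_sym : symmetric del_adj.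
Proof. by move=> x y; rewrite /del_adj adj_sym. Qed.

Lemma del_adj_irrefl : irreflexive del_adj.
Proof. by move=> x; rewrite /del_adj adj_irrefl. Qed.

Definition del_vertex : sgraph := SGraph del_adj_sym del_adj_irrefl.

End DeleteVertex.

Definition turan_plus_pendant (r m : nat) (G : sgraph) : Prop :=
  exists v : G, degree v = 1 /\ graph_iso (del_vertex v) (turan r m).

(* Main.v *)
Require Import Defs.
From mathcomp Require Import all_boot zify.

Set Implicit Arguments.
Unset Strict Implicit.
Unset Printing Implicit Defensive.

(** Let [t r n] be the number of edges of the Turan graph. Suppose that [G] is
    [K_(r+1)]-free with [n] vertices and at least [t r (n - 1) + 2] edges; it is
    shown to be chorded pancyclic.

    [G] is Hamiltonian. By the theorem of Posa and Chvatal ([posa]), a graph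
    without Hamiltonian cycle has, for some [0 < k < n / 2], a set of [k]
    vertices of degree at most [k]. These meet at most [k ^ 2] edges and the
    other [n - k] vertices span at most [t r (n - k)] edges by Turan's theorem
    ([turan_bound]), and [k ^ 2 + t r (n - k) <= t r (n - 1) + 1]. This
    inequality fails only for [r = 3] and [n = 2 k + 1]; there a closer look at
    the edges between the two sets gives the missing linear term
    ([low_degree_half3]).

    [G] has cycles of all lengths. It has more than [n ^ 2 / 4] edges, so
    Bondy's argument ([bondy]) applies: two consecutive vertices of the
    Hamiltonian cycle have degrees adding up to more than [n], and two of their
    edges cut out a cycle of any given length [k].

    Some [k]-cycle has a chord. Otherwise take a [k]-cycle [C] and a vertex [v]
    outside it. If [v] is adjacent to two vertices of [C] at distance two, it
    can replace the vertex between them, and since the new cycle has no chord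
    either, [v] has at most three neighbours on [C]. If there are no such two
    vertices, [v] is adjacent to at most half of [C]. So about
    [k + (n - k) k / 2 + t r (n - k)] edges are all that [G] can have, and this
    is less than [t r (n - 1) + 2]. For [k = 5], where three exceeds [k / 2],
    three neighbours per vertex are still few enough if [r > 3]; if [r = 3], it
    is used in addition that any three consecutive vertices of [C] have at most
    one common neighbour outside [C] ([common_triple5]).

    Edge counts are done on ordered pairs ([arcs]), that is, doubled. *)

(** * Turan numbers *)

(** When the parts are the residue classes modulo [r], vertex [j] is not adjacent
    to exactly [j %/ r] of the vertices before it. *)
Definition turan_size (r n : nat) : nat := \sum_(j < n) (j - j %/ r).

Lemma turan_sizeS r n : turan_size r n.+1 = turan_size r n + (n - n %/ r).
Proof. by rewrite /turan_size big_ord_recr. Qed.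

(** With [s = n mod r], this is the count of pairs in a balanced partition into
    [s] parts of one size and [r - s] parts of the next smaller one. *)
Lemma turan_size_formula r n : 0 < r ->
  2 * r * turan_size r n + (n %% r) * (r - n %% r) = r.-1 * n ^ 2.
Proof.
move=> r_gt0; elim: n => [|n IHn]; first by rewrite /turan_size big_ord0 mod0n; lia.
rewrite turan_sizeS.
have lt_sr := ltn_pmod n r_gt0; have def_n := divn_eq n r.
move: (n %/ r) (n %% r) lt_sr def_n IHn => q s lt_sr def_n IHn.
have -> : n.+1 %% r = if s.+1 == r then 0 else s.+1.
  rewrite def_n -addnS modnMDl; case: eqP => [->|ne_sr]; first by rewrite modnn.
  by rewrite modn_small //; lia.
have [p [def_r ->]] : exists p, r = p.+1 /\ r.-1 = p by exists r.-1; lia.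
have [e def_e] : exists e, s + e = p by exists (p - s); lia.
have -> : n - q = q * p + s by rewrite def_n def_r; nia.
rewrite -!mulnn in IHn *; case: eqP => [eq_sr|_].
  have ? : s = p by lia.
  by subst; nia.
have {}IHn: 2 * r * turan_size r n + s * e.+1 = p * (n * n).
  by rewrite -[e.+1](_ : r - s = _) ?IHn; [ congr (_ * _); lia | lia ].
have -> : r - s.+1 = e by lia.
by subst; nia.
Qed.

(** For [r < 8] the correction [s * (r - s)] is too small to be seen by the
    floor. *)
Lemma turan_size_floor r n : 0 < r < 8 ->
  turan_size r n = (r.-1 * n ^ 2) %/ (2 * r).
Proof.
case/andP=> r_gt0 lt_r8; rewrite -turan_size_formula //.
have := ltn_pmod n r_gt0; move: (n %% r) => s lt_sr.
rewrite mulnC divnMDl ?muln_gt0 // divn_small ?addn0 //.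
have [d def_r] : exists d, r = s + d by exists (r - s); lia.
have -> : r - s = d by lia.
have : 0 < d by lia.
have : s + d <= 7 by lia.
by rewrite def_r; case: s {lt_sr def_r} => [|[|[|[|[|[|[|s]]]]]]]; lia.
Qed.

(** One more vertex in each part. *)
Lemma turan_size_addr r m : 0 < r ->
  2 * turan_size r (m + r) =
  2 * turan_size r m + 2 * (m * r.-1) + r * r.-1.
Proof.
move=> r_gt0; have := turan_size_formula (m + r) r_gt0.
rewrite modnDr; have := turan_size_formula m r_gt0.
move: (_ %% r * _) (r.-1) => c p eq_m eq_mr.
apply/eqP; rewrite -(eqn_pmul2l r_gt0) -(eqn_add2r c); apply/eqP.
by rewrite -!mulnn in eq_m eq_mr; nia.
Qed.

(** Each increment [j - j %/ r] grows with [r], so inequalities between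
    Turan numbers of the form below need only be checked for the smallest [r]. *)
Lemma turan_size_diff_mono r r' m m' : 0 < r -> r <= r' -> m <= m' ->
  turan_size r m' + turan_size r' m <= turan_size r' m' + turan_size r m.
Proof.
move=> r_gt0 le_rr'; elim: m' => [|m' IHm]; first by rewrite leqn0 => /eqP->; lia.
rewrite leq_eqVlt => /orP[/eqP->|]; first by lia.
rewrite ltnS => /IHm; rewrite !turan_sizeS.
have := leq_div2l m' r_gt0 le_rr'; lia.
Qed.

Lemma turan_size_mono r r' n :
  0 < r -> r <= r' -> turan_size r n <= turan_size r' n.
Proof.
move=> r_gt0 le_rr'; have := turan_size_diff_mono r_gt0 le_rr' (leq0n n).
by rewrite {2 4}/turan_size !big_ord0 !addn0.
Qed.

(** * Counting edges by ordered pairs *)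

Definition nbrs_in (G : sgraph) (B : {set G}) (x : G) : nat :=
  \sum_(y in B) adj x y.

(** Edges inside [A] are counted twice by [arcs A A], and [arcs] is additive and
    symmetric in its two arguments. *)
Definition arcs (G : sgraph) (A B : {set G}) : nat :=
  \sum_(x in A) nbrs_in B x.

Section Arcs.
Variable G : sgraph.
Implicit Types (A B C S : {set G}) (x y v : G).

Lemma nbrs_in_card B x : nbrs_in B x = #|[set y in B | adj x y]|.
Proof.
rewrite /nbrs_in -sum1_card big_mkcond [RHS]big_mkcond.
by apply: eq_bigr => y _; rewrite inE; case: (y \in B); case: (adj x y).
Qed.

Lemma degree_nbrs_in x : degree x = nbrs_in [set: G] x.
Proof. by rewrite nbrs_in_card; apply: eq_card => y; rewrite !inE. Qed.

Lemma nbrs_in_le B x : nbrs_in B x <= #|B|.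
Proof.
by rewrite nbrs_in_card subset_leq_card //; apply/subsetP=> y; rewrite inE => /andP[].
Qed.

Lemma nbrs_in_lt B x : x \in B -> nbrs_in B x < #|B|.
Proof.
move=> Bx; rewrite nbrs_in_card; apply: proper_card; apply/properP.
split; first by apply/subsetP=> y; rewrite inE => /andP[].
by exists x => //; rewrite inE adj_irrefl andbF.
Qed.

Lemma nbrs_in_split A B x :
  nbrs_in A x = nbrs_in (A :&: B) x + nbrs_in (A :\: B) x.
Proof. exact: big_setID. Qed.

Lemma arcs_sym A B : arcs A B = arcs B A.
Proof.
rewrite /arcs exchange_big; apply: eq_bigr => y _.
by apply: eq_bigr => x _; rewrite adj_sym.
Qed.

Lemma arcs_splitl A B C :
  arcs A C = arcs (A :&: B) C + arcs (A :\: B) C.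
Proof. exact: big_setID. Qed.

Lemma arcs_splitr A B C :
  arcs C A = arcs C (A :&: B) + arcs C (A :\: B).
Proof. by rewrite ![arcs C _]arcs_sym -arcs_splitl. Qed.

Lemma arcs_diag_split A B : B \subset A ->
  arcs A A = arcs B B + 2 * arcs (A :\: B) B + arcs (A :\: B) (A :\: B).
Proof.
move=> sBA; rewrite (arcs_splitl A B A) !(arcs_splitr A B) (setIidPr sBA).
by rewrite (arcs_sym B (A :\: B)); lia.
Qed.

Lemma arcs_le_mul A B d :
  {in A, forall x, nbrs_in B x <= d} -> arcs A B <= #|A| * d.
Proof. by move=> le_d; rewrite -sum_nat_const; apply: leq_sum. Qed.

(** Each edge is the image of exactly two ordered pairs. *)
Lemma double_num_edges : 2 * num_edges G = arcs [set: G] [set: G].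
Proof.
pose P := [set p : G * G | adj p.1 p.2].
have -> : arcs [set: G] [set: G] = #|P|.
  rewrite -sum1_card big_mkcond /arcs /nbrs_in.
  under eq_bigl do rewrite inE.
  under eq_bigr => x _ do under eq_bigl do rewrite inE.
  rewrite pair_big; apply: eq_bigr => -[x y] _ /=.
  by rewrite inE; case: (adj x y).
pose f (p : G * G) : {set G} := [set p.1; p.2].
rewrite -sum1_card (partition_big f (mem (edges G))) => [|[x y]]; last first.
  by rewrite !inE /= => xy; apply/existsP; exists x; apply/existsP; exists y; rewrite xy /=.
rewrite mulnC /num_edges -sum_nat_const; apply: eq_bigr => E.
rewrite inE => /existsP[x /existsP[y /andP[xy /eqP->]]].
have ne_xy : x != y by apply: contraTneq xy => ->; rewrite adj_irrefl.
rewrite sum1_card -[2](_ : #|[set (x, y); (y, x)]| = 2); last first.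
  by rewrite cards2 xpair_eqE (negPf ne_xy).
apply: eq_card => -[a b]; rewrite [RHS]unfold_in /f /P /= !inE /= !xpair_eqE.
apply/idP/idP.
  case/orP=> /andP[/eqP-> /eqP->]; first by rewrite xy eqxx.
  by rewrite adj_sym xy setUC eqxx.
case/andP=> ab /eqP/setP eqE.
have ne_ab : a != b by apply: contraTneq ab => ->; rewrite adj_irrefl.
have := eqE a; have := eqE b; rewrite !inE !eqxx orbT /=.
move=> /esym/orP[]/eqP eb /esym/orP[]/eqP ea; rewrite ea eb ?eqxx ?orbT //;
  by rewrite ea eb eqxx in ne_ab.
Qed.

End Arcs.

(** * Turan's theorem *)

(** A boolean form of cliques in [A], for case distinctions. *)
Definition has_clique_in (G : sgraph) (k : nat) (A : {set G}) : bool :=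
  [exists B : {set G}, [&& B \subset A, #|B| == k &
     [forall x in B, forall y in B, (x != y) ==> adj x y]]].

Lemma has_clique_inP (G : sgraph) k (A : {set G}) :
  reflect (exists B : {set G}, [/\ B \subset A, #|B| = k & clique B])
          (has_clique_in k A).
Proof.
apply: (iffP existsP) => -[B].
  case/and3P=> sBA /eqP cardB /forall_inP clB; exists B; split=> // x y Bx By ne_xy.
  by have /forall_inP/(_ y By)/implyP/(_ ne_xy) := clB x Bx.
case=> sBA cardB clB; exists B; rewrite sBA cardB eqxx /=.
apply/forall_inP=> x Bx; apply/forall_inP=> y By; apply/implyP; exact: clB.
Qed.

Section TuranTheorem.
Variable G : sgraph.
Implicit Types (A B : {set G}).

Lemma has_clique_in_mono k A B :
  A \subset B -> has_clique_in k A -> has_clique_in k B.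
Proof.
move=> sAB /has_clique_inP[C [sCA cardC clC]]; apply/has_clique_inP.
by exists C; split=> //; apply: subset_trans sCA sAB.
Qed.

Lemma K_free_has_clique_in k A : K_free k G -> ~~ has_clique_in k A.
Proof. by move=> Kfree; apply/has_clique_inP=> -[B [_ ? ?]]; apply: Kfree; exists B. Qed.

(** A vertex joined to all of a clique would enlarge it. *)
Lemma clique_nbrs_in r A B x :
  ~~ has_clique_in r.+1 A -> B \subset A -> clique B -> #|B| = r ->
  x \in A -> nbrs_in B x <= r.-1.
Proof.
move=> noK sBA clB cardB Ax; case: (boolP (x \in B)) => [Bx|nBx].
  by have := nbrs_in_lt Bx; lia.
have := nbrs_in_le B x; rewrite cardB leq_eqVlt => /orP[/eqP eq_r|]; last by lia.
case/negP: noK; apply/has_clique_inP; exists (x |: B); split.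
- by rewrite subUset sub1set Ax.
- by rewrite cardsU1 nBx cardB.
have adjB y : y \in B -> adj x y.
  have sub : [set y in B | adj x y] \subset B.
    by apply/subsetP=> z; rewrite inE => /andP[].
  have /eqP eqB : [set y in B | adj x y] == B.
    by rewrite eqEcard sub -nbrs_in_card eq_r cardB leqnn.
  by rewrite -{1}eqB inE => /andP[].
move=> y z /setU1P[->|By] /setU1P[->|Bz]; rewrite ?eqxx //.
- by move=> _; apply: adjB.
- by move=> _; rewrite adj_sym; apply: adjB.
exact: clB.
Qed.

(** If [A] contains a [K_r], remove it: it has [r (r - 1)] arcs and every other
    vertex sends at most [r - 1] edges to it, exactly as when one vertex is
    removed from each part of the Turan graph. Otherwise the bound for [r - 1]
    is stronger. *)
Theorem turan_bound r A : 0 < r -> ~~ has_clique_in r.+1 A ->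
  arcs A A <= 2 * turan_size r #|A|.
Proof.
case: r => // r _; elim: r A => [|r IHr] A.
  move=> noK; rewrite /arcs big1 // => x Ax; rewrite /nbrs_in big1 // => y Ay.
  case: (boolP (adj x y)) => // xy; case/negP: noK; apply/has_clique_inP.
  have ne_xy : x != y by apply: contraTneq xy => ->; rewrite adj_irrefl.
  exists [set x; y]; split; first by rewrite subUset !sub1set Ax.
    by rewrite cards2 ne_xy.
  by move=> a b /set2P[]-> /set2P[]->; rewrite ?eqxx // adj_sym.
have [m] := ubnP #|A|; elim: m A => // m IHm A ltAm noK.
case: (boolP (has_clique_in r.+2 A)) => [/has_clique_inP[B [sBA cardB clB]]|noKr].
  have cardAB : #|A| = #|A :\: B| + r.+2 by rewrite -(cardsID B A) (setIidPr sBA) cardB addnC.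
  rewrite (arcs_diag_split sBA) cardAB turan_size_addr //=.
  have inB : arcs B B <= r.+2 * r.+1.
    by rewrite -cardB; apply: arcs_le_mul => x /nbrs_in_lt; rewrite cardB ltnS.
  have outB : arcs (A :\: B) B <= #|A :\: B| * r.+1.
    apply: arcs_le_mul => x /setDP[Ax _].
    exact: clique_nbrs_in noK sBA clB cardB Ax.
  have := IHm (A :\: B); rewrite (contra (has_clique_in_mono (subsetDl A B)) noK).
  by move/(_ ltac:(lia) isT); lia.
apply: leq_trans (IHr A noKr) _.
by rewrite leq_mul2l /= turan_size_mono.
Qed.

(** Inside the neighbourhood of a vertex one clique size is lost. *)
Lemma nbrs_clique_free k A x :
  K_free k.+1 G -> ~~ has_clique_in k [set y in A | adj x y].
Proof.
move=> Kfree; apply/has_clique_inP=> -[B [sBN cardB clB]]; apply: Kfree.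
have adjB y : y \in B -> adj x y by move/(subsetP sBN); rewrite inE => /andP[].
exists (x |: B); split; last first.
  rewrite cardsU1 cardB [_ \notin _](_ : _ = true) //.
  by apply/negP=> /adjB; rewrite adj_irrefl.
move=> y z /setU1P[->|By] /setU1P[->|Bz]; rewrite ?eqxx //.
- by move=> _; apply: adjB.
- by move=> _; rewrite adj_sym; apply: adjB.
exact: clB.
Qed.

End TuranTheorem.

Lemma num_edges_turan r n : 0 < r -> num_edges (turan r n) = turan_size r n.
Proof.
move=> r_gt0; apply/eqP; rewrite -(eqn_pmul2l (ltn0Sn 1)) double_num_edges.
have -> : arcs [set: turan r n] [set: turan r n] =
    \sum_(x < n) \sum_(y < n) (x %% r != y %% r).
  rewrite /arcs /nbrs_in; under eq_bigl do rewrite inE.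
  by under eq_bigr => x _ do under eq_bigl do rewrite inE.
apply/eqP; elim: n => [|n IHn]; first by rewrite /turan_size !big_ord0.
have last_row : \sum_(y < n) (n %% r != y %% r) = n - n %/ r.
  set P := turan_part n (Ordinal (ltn_pmod n r_gt0)).
  have cardP : #|P| = n %/ r by rewrite card_turan_part /= ltnn addn0.
  have : #|P| + #|~: P| = n by rewrite cardsC card_ord.
  rewrite cardP => /(canRL (addKn _))<-.
  rewrite -sum1_card [RHS]big_mkcond; apply: eq_bigr => y _.
  by rewrite !inE /= eq_sym; case: eqP.
rewrite big_ord_recr /= big_ord_recr /= eqxx addn0 last_row.
under eq_bigr => x _ do rewrite big_ord_recr /= eq_sym.
rewrite big_split /= last_row turan_sizeS.
by rewrite IHn; lia.
Qed.

(** * Hamiltonian cycles *)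

Lemma sum_next (T : eqType) (c : seq T) (F : T -> nat) :
  uniq c -> \sum_(x <- c) F (next c x) = \sum_(x <- c) F x.
Proof.
move=> Uc; rewrite -(big_map (next c) xpredT); apply: perm_big; apply: uniq_perm => //.
  by rewrite map_inj_in_uniq // => x y _ _ /(can_inj (prev_next Uc)).
move=> x; apply/mapP/idP=> [[y cy ->]|cx]; first by rewrite mem_next.
by exists (prev c x); rewrite ?mem_prev ?next_prev.
Qed.

Section Hamiltonicity.
Variable T : finType.
Implicit Types (e : rel T) (x y u v : T) (s p c : seq T).

Definition hamiltonian e : Prop := exists c, ucycle e c /\ size c = #|T|.

Definition rel_degree e x : nat := \sum_(y : T) e x y.

Lemma spanning_seq_mem s y : uniq s -> size s = #|T| -> y \in s.
Proof.
move=> Us size_s.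
have /subset_cardP/(_ (subset_predT _))-> // : #|s| = #|T| by rewrite (card_uniqP Us).
Qed.

Lemma sum_spanning_seq s (F : T -> nat) :
  uniq s -> size s = #|T| -> \sum_(y : T) F y = \sum_(y <- s) F y.
Proof.
by move=> Us size_s; rewrite [RHS]big_uniq //; apply: eq_bigl => y; rewrite spanning_seq_mem.
Qed.

(** Two paths closed into one cycle by joining their heads and their ends. *)
Lemma cycle_crossing e x y p q : symmetric e ->
  path e x p -> path e y q -> e x y -> e (last x p) (last y q) ->
  cycle e (x :: p ++ rev (y :: q)).
Proof.
move=> e_sym px qy xy last_pq.
rewrite /= rcons_path last_cat rev_cons last_rcons e_sym xy andbT.
rewrite cat_path px /= -rev_cons lastI rev_rcons /= last_pq rev_path.
by rewrite (eq_path (e' := e)) // => a b; rewrite e_sym.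
Qed.

(** Among the [n - 1] places [i] of a Hamiltonian path, some [i] has the first
    vertex adjacent to vertex [i + 1] and the last one adjacent to vertex [i];
    exchanging one edge for these two closes the path. *)
Lemma hamiltonian_path_closes e x p : symmetric e -> irreflexive e ->
  path e x p -> uniq (x :: p) -> size (x :: p) = #|T| ->
  #|T| <= rel_degree e x + rel_degree e (last x p) -> hamiltonian e.
Proof.
move=> e_sym e_irr px Ups size_p; rewrite -size_p.
have degE z : rel_degree e z = \sum_(0 <= i < (size p).+1) e z (nth x (x :: p) i).
  by rewrite /rel_degree (sum_spanning_seq _ Ups size_p) (big_nth x).
have -> : rel_degree e x = \sum_(0 <= i < size p) e x (nth x p i).
  by rewrite degE big_nat_recl //= e_irr.
have -> : rel_degree e (last x p) =
    \sum_(0 <= i < size p) e (last x p) (nth x (x :: p) i).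
  by rewrite degE big_nat_recr //= -last_nth e_irr addn0.
rewrite -big_split /=; case: (boolP (has (fun i => e x (nth x p i) &&
    e (last x p) (nth x (x :: p) i)) (iota 0 (size p)))) => [|no_i].
  case/hasP=> i; rewrite mem_iota add0n => /= lt_ip /andP[e_x e_last].
  have def_p : p = take i p ++ nth x p i :: drop i.+1 p by rewrite -drop_nth // cat_take_drop.
  have last_take : last x (take i p) = nth x (x :: p) i.
    rewrite (last_nth x) size_takel ?(ltnW lt_ip) // -[x :: take i p]/(take i.+1 (x :: p)).
    by rewrite nth_take.
  have last_drop : last (nth x p i) (drop i.+1 p) = last x p.
    by rewrite [in RHS]def_p last_cat.
  exists (x :: take i p ++ rev (nth x p i :: drop i.+1 p)); split; last first.
    by rewrite /= size_cat size_rev -size_cat -def_p.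
  move: px; rewrite {1}def_p cat_path /= => /and3P[px _ qx].
  rewrite /ucycle cycle_crossing ?last_take ?last_drop // ?[e _ (last x p)]e_sym //=.
  rewrite -[_ && _]/(uniq (x :: _)) (perm_uniq (s2 := x :: p)) // perm_cons.
  by rewrite [X in perm_eq _ X]def_p perm_cat2l perm_rev.
rewrite [_ <= _](_ : _ = false) //; apply/negbTE; rewrite -ltnNge ltnS.
rewrite -[leqRHS]subn0 -[leqRHS]mul1n mulnC -sum_nat_const_nat.
rewrite big_nat [leqRHS]big_nat; apply: leq_sum => i lt_ip.
move/hasPn/(_ i): no_i; rewrite mem_iota add0n => /(_ lt_ip).
by case: (e x _); case: (e (last x p) _).
Qed.

Definition add_edge e u v : rel T :=
  fun x y => [|| e x y, (x == u) && (y == v) | (x == v) && (y == u)].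

Lemma add_edge_sym e u v : symmetric e -> symmetric (add_edge e u v).
Proof. by move=> e_sym x y; rewrite /add_edge e_sym; do !case: eqP; rewrite ?orbT. Qed.

Lemma add_edge_off e u v x y : x != u -> y != u -> add_edge e u v x y = e x y.
Proof. by move=> /negPf ne_xu /negPf ne_yu; rewrite /add_edge ne_xu ne_yu andbF !orbF. Qed.

Lemma add_edge_from e u v x : u != v -> add_edge e u v u x = e u x || (x == v).
Proof. by move=> /negPf ne_uv; rewrite /add_edge eqxx ne_uv orbF. Qed.

(** A Hamiltonian cycle using the new edge is a Hamiltonian path of the old
    graph from [u] to [v] or back. *)
Lemma hamiltonian_add_edge e u v : symmetric e -> irreflexive e ->
  2 < #|T| -> u != v -> #|T| <= rel_degree e u + rel_degree e v ->
  hamiltonian (add_edge e u v) -> hamiltonian e.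
Proof.
move=> e_sym e_irr n_gt2 ne_uv deg_uv [c [/andP[cyc_c Uc] size_c]].
have /rot_to[i s def_c] : u \in c by apply: spanning_seq_mem.
have {cyc_c}: cycle (add_edge e u v) (u :: s) by rewrite -def_c rot_cycle.
have {Uc}Us : uniq (u :: s) by rewrite -def_c rot_uniq.
have {def_c size_c}size_s : size (u :: s) = #|T| by rewrite -def_c size_rot.
case: s => [|h s] in Us size_s *; first by rewrite -size_s in n_gt2.
have us_u : all (predC1 u) (h :: s).
  by case/andP: Us => nsu _; apply/allP=> x sx; apply: contraNneq nsu => <-.
rewrite /= rcons_path [add_edge _ _ _ _ u]add_edge_sym // !add_edge_from //.
have /eq_in_path-> // : {in predC1 u &, add_edge e u v =2 e}.
  by move=> x y ne_xu ne_yu; apply: add_edge_off.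
case/and3P=> uh hs ul.
case: (boolP (e u h)) uh => [uh _|_ /= /eqP def_h].
  case: (boolP (e u (last h s))) ul => [ul _|_ /= /eqP def_l].
    exists (u :: h :: s); split=> //.
    by rewrite /ucycle Us /= rcons_path uh hs e_sym ul.
  apply: (hamiltonian_path_closes e_sym e_irr (x := u) (p := h :: s)) => //=.
    by rewrite uh.
  by rewrite def_l.
subst h; case/orP: ul => [ul|/eqP def_l].
  apply: (hamiltonian_path_closes e_sym e_irr (x := v) (p := rcons s u)) => //.
  - by rewrite rcons_path hs e_sym.
  - by rewrite -rcons_cons rcons_uniq.
  - by rewrite -rcons_cons size_rcons.
  by rewrite last_rcons addnC.
case: s => [|x s] in def_l Us size_s {hs us_u} *; first by rewrite -size_s in n_gt2.
by move: Us; rewrite -def_l /= mem_last !andbF.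
Qed.

(** Add edges one by one, always joining a non-adjacent pair [u, v] of largest
    degree sum. If this sum is below [n] and [u] has the smaller degree [k],
    then each of the at least [k] vertices not adjacent to [v] has degree at
    most [k], by the choice of the pair. *)
Theorem posa e : symmetric e -> irreflexive e -> 2 < #|T| ->
  (forall k, 0 < k -> 2 * k < #|T| ->
     #|[set x | rel_degree e x <= k]| < k) ->
  hamiltonian e.
Proof.
move=> e_sym e_irr n_gt2.
pose nonadj e (p : T * T) := (p.1 != p.2) && ~~ e p.1 p.2.
have [m] := ubnP #|[set p | nonadj e p]|.
elim: m e e_sym e_irr => // m IHm e e_sym e_irr lt_m few_low.
case: (pickP (nonadj e)) => [p0 p0_nonadj|complete]; last first.
  have joined x y : x != y -> e x y.
    by move=> ne_xy; have := complete (x, y); rewrite /nonadj /= ne_xy => /negbFE.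
  exists (enum T); split; last by rewrite -cardE.
  rewrite /ucycle enum_uniq andbT.
  have := enum_uniq T; have : 2 < size (enum T) by rewrite -cardE.
  case: (enum T) => // x s size_s Us; rewrite /= rcons_path joined ?andbT.
    apply: (@pairwise_sorted _ e (x :: s)).
    by move: Us; rewrite uniq_pairwise; apply: sub_pairwise => a b /joined.
  case: s Us size_s => // y s /= /andP[nsx _] _.
  by apply: contraNneq nsx => <-; rewrite mem_last.
have [[u v] /= /andP[/= ne_uv nuv] max_uv] :=
  arg_maxnP (fun p : T * T => rel_degree e p.1 + rel_degree e p.2) p0_nonadj.
wlog le_uv : u v ne_uv nuv max_uv / rel_degree e u <= rel_degree e v.
  move=> IH; case/orP: (leq_total (rel_degree e u) (rel_degree e v)) => le_uv.
    exact: (IH u v).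
  apply: (IH v u); rewrite 1?eq_sym 1?e_sym //.
  by move=> p /max_uv; rewrite /= addnC [in leqRHS]addnC.
have [le_n|lt_n] := leqP #|T| (rel_degree e u + rel_degree e v).
  apply: (hamiltonian_add_edge e_sym e_irr n_gt2 ne_uv le_n).
  apply: IHm.
  - exact: add_edge_sym.
  - by move=> x; rewrite /add_edge e_irr; case: eqP => [->|_]; rewrite ?(negPf ne_uv) ?andbF.
  - rewrite ltnS in lt_m; apply: leq_trans lt_m; apply: proper_card; apply/properP; split.
      by apply/subsetP=> p; rewrite !inE /nonadj /add_edge negb_or => /and3P[-> ->].
    by exists (u, v); rewrite !inE /nonadj /add_edge /= ?eqxx ?orbT ?ne_uv ?nuv ?andbF.
  move=> k k_gt0 lt_kn; apply: leq_ltn_trans (few_low k k_gt0 lt_kn).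
  apply: subset_leq_card; apply/subsetP=> x; rewrite !inE; apply: leq_trans.
  by apply: leq_sum => y _; rewrite /add_edge; case: (e x y).
pose k := rel_degree e u.
have low_k : [set w | (w != v) && ~~ e v w] \subset [set x | rel_degree e x <= k].
  apply/subsetP=> w; rewrite !inE => /andP[ne_wv nvw].
  have := max_uv (w, v); rewrite /nonadj /= ne_wv e_sym nvw => /(_ isT).
  by rewrite leq_add2r.
have card_low : #|[set w | (w != v) && ~~ e v w]| + rel_degree e v = #|T|.-1.
  rewrite -(cardsC1 v) -sum1_card big_mkcond /rel_degree -big_split -sum1_card /=.
  rewrite [RHS]big_mkcond; apply: eq_bigr => w _; rewrite !inE.
  by case: eqP => [->|_] /=; rewrite ?e_irr //; case: (e v w).
have := subset_leq_card low_k.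
case: (posnP k) => [k0|k_gt0]; last first.
  by have := few_low k k_gt0; rewrite /k in k_gt0 *; lia.
(* An isolated [u] contradicts the hypothesis for [k = 1]. *)
have := few_low 1 isT n_gt2; rewrite ltnS leqn0 cards_eq0 => /eqP/setP/(_ u).
by rewrite !inE -/k k0.
Qed.

(** For two consecutive vertices [x], [y] of a Hamiltonian cycle there is a
    bijection [b |-> a] between the [n - 2] other positions such that an edge
    from [y] to position [b] and an edge from [x] to position [a] give together
    a cycle of length [k]: going from [b] up to [a] if [b] is small, and
    using the crossing otherwise. Hence [k]-cycles can be missing only if
    the two degrees add up to at most [n]. *)
Lemma bondy_pair e y s k : symmetric e -> irreflexive e ->
  ucycle e (y :: s) -> size (y :: s) = #|T| -> 2 < k < #|T| ->
  #|T| < rel_degree e y + rel_degree e (last y s) ->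
  exists c, ucycle e c /\ size c = k.
Proof.
move=> e_sym e_irr /andP[cyc Us] size_s /andP[k_gt2 lt_kn] deg_xy.
have [n def_n] : exists n, #|T| = n by exists #|T|.
have size_n : size (y :: s) = n by rewrite size_s.
rewrite def_n in lt_kn deg_xy; pose v i := nth y (y :: s) i.
have v_last : last y s = v n.-1 by rewrite -size_n /= (last_nth y).
have vS i : i.+1 < n -> e (v i) (v i.+1).
  move: cyc; rewrite /= rcons_path => /andP[/(pathP y) ys _] lt_in.
  by apply: ys; rewrite -size_n in lt_in.
have v_close : e (v n.-1) (v 0).
  by move: cyc; rewrite /= rcons_path v_last => /andP[].
have v_inj : {in gtn n &, injective v}.
  move=> i j; rewrite !inE => lt_in lt_jn /eqP.
  by rewrite nth_uniq ?size_n // => /eqP.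
have seg_path i m : i + m < n -> path e (v i) [seq v j | j <- iota i.+1 m].
  by elim: m i => //= m IHm i lt_n; rewrite vS ?IHm //; lia.
have seg_last i m : last (v i) [seq v j | j <- iota i.+1 m] = v (i + m).
  by elim: m i => [|m IHm] i /=; rewrite ?addn0 // IHm addnS.
have v_uniq t : uniq t -> all (gtn n) t -> uniq (map v t).
  move=> Ut /allP lt_tn; rewrite map_inj_in_uniq // => i j /lt_tn ? /lt_tn ?.
  exact: v_inj.
have degE z : rel_degree e z = \sum_(0 <= i < n) e z (v i).
  by rewrite /rel_degree (sum_spanning_seq _ Us size_s) (big_nth y) size_n.
have deg_y : rel_degree e y <= (\sum_(1 <= b < n.-1) e y (v b)).+1.
  rewrite degE big_ltn ?e_irr; last by lia.
  by rewrite -[n in leqLHS](@prednK n) ?big_nat_recr //=; lia.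
have deg_x : rel_degree e (last y s) <= (\sum_(1 <= a < n.-1) e (v n.-1) (v a)).+1.
  rewrite degE v_last big_ltn; last by lia.
  by rewrite -[n in leqLHS](@prednK n) ?big_nat_recr /= ?e_irr //; lia.
case: (boolP (has (fun b => e y (v b) && e (v n.-1) (v (b + (k - 3))))
  (iota 1 (n - k + 1)))) => [/hasP[b]|no_direct].
  rewrite mem_iota => b_range /andP[yb xa].
  exists (map v (0 :: iota b (k - 2) ++ [:: n.-1])); split; last first.
    by rewrite /= size_map size_cat size_iota /=; lia.
  rewrite /ucycle v_uniq; first last.
  - by rewrite /= all_cat /=; apply/and3P; split; [lia|apply/allP=> i; rewrite mem_iota /=; lia|lia].
  - rewrite /= mem_cat cat_uniq iota_uniq mem_iota mem_seq1 /= mem_iota.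
    by rewrite !orbF !andbT; lia.
  have -> : k - 2 = (k - 3).+1 by lia.
  rewrite andbT /= rcons_path map_cat last_cat cat_path /= seg_last yb /=.
  by rewrite seg_path ?v_close ?[e _ (v n.-1)]e_sym ?xa //; lia.
case: (boolP (has (fun a => e y (v (a + (n - k + 1))) && e (v n.-1) (v a))
  (iota 1 (k - 3)))) => [/hasP[a]|no_crossing].
  rewrite mem_iota => a_range /andP[yb xa]; set b := a + (n - k + 1) in yb.
  have seg_b : [seq v i | i <- iota b (n - b)] =
               v b :: [seq v i | i <- iota b.+1 (n - b).-1].
    by have -> : n - b = (n - b).-1.+1 by rewrite /b; lia.
  exists (map v (iota 0 a.+1 ++ rev (iota b (n - b)))); split; last first.
    by rewrite size_map size_cat size_rev !size_iota /b; lia.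
  rewrite /ucycle v_uniq; first last.
  - rewrite all_cat all_rev; apply/andP; split; apply/allP=> i; rewrite mem_iota /b /=; lia.
  - rewrite cat_uniq rev_uniq !iota_uniq andbT /=; apply/hasPn=> i.
    by rewrite mem_rev /= in_cons !mem_iota /b; lia.
  rewrite andbT map_cat map_rev seg_b.
  apply: cycle_crossing => //; rewrite ?seg_path ?seg_last /b ?add0n //; try lia.
  by rewrite e_sym; have -> : a + (n - k + 1) + (n - (a + (n - k + 1))).-1 = n.-1 by lia.
have split_y : \sum_(1 <= b < n.-1) e y (v b) =
    \sum_(1 <= b < n - k + 2) e y (v b) +
    \sum_(1 <= a < k - 2) e y (v (a + (n - k + 1))).
  rewrite (@big_cat_nat _ _ _ (n - k + 2)) /=; try lia.
  congr (_ + _); rewrite -[n - k + 2](_ : 1 + (n - k + 1) = _); last by lia.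
  by rewrite big_addn; congr (\sum_(1 <= a < _) _); lia.
have split_x : \sum_(1 <= a < n.-1) e (v n.-1) (v a) =
    \sum_(1 <= b < n - k + 2) e (v n.-1) (v (b + (k - 3))) +
    \sum_(1 <= a < k - 2) e (v n.-1) (v a).
  rewrite (@big_cat_nat _ _ _ (k - 2)) /=; try lia.
  rewrite addnC; congr (_ + _); rewrite -[k - 2](_ : 1 + (k - 3) = _); last by lia.
  by rewrite big_addn; congr (\sum_(1 <= a < _) _); lia.
have sum_le1 (f g : nat -> bool) m :
    ~~ has (fun i => f i && g i) (iota 1 m) ->
    \sum_(1 <= i < m.+1) f i + \sum_(1 <= i < m.+1) g i <= m.
  move=> /hasPn no_fg; apply: (@leq_trans (\sum_(1 <= i < m.+1) 1)); last first.
    by rewrite sum_nat_const_nat muln1 subSS subn0.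
  rewrite -big_split /= big_nat [leqRHS]big_nat; apply: leq_sum => i i_range.
  by have := no_fg i; rewrite mem_iota add1n => /(_ i_range); case: (f i); case: (g i).
move: {sum_le1}(sum_le1 _ _ _ no_direct) (sum_le1 _ _ _ no_crossing).
have -> : (n - k + 1).+1 = n - k + 2 by lia.
have -> : (k - 3).+1 = k - 2 by lia.
by move: deg_xy deg_x deg_y; rewrite split_x split_y; lia.
Qed.

(** Averaging over the consecutive pairs of a Hamiltonian cycle. *)
Theorem bondy e k : symmetric e -> irreflexive e -> hamiltonian e ->
  2 < k <= #|T| -> #|T| ^ 2 < 2 * \sum_x rel_degree e x ->
  exists c, ucycle e c /\ size c = k.
Proof.
move=> e_sym e_irr [c [Hc size_c]] /andP[k_gt2 le_kn] many_edges.
move: le_kn; rewrite leq_eqVlt => /orP[/eqP->|lt_kn]; first by exists c.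
have [cyc Uc] := andP Hc.
case: (boolP (has (fun y => #|T| < rel_degree e y + rel_degree e (prev c y)) c)).
  case/hasP=> y cy deg_y; have [i s def_c] := rot_to cy.
  have Uys : uniq (y :: s) by rewrite -def_c rot_uniq.
  apply: (bondy_pair (y := y) (s := s) e_sym e_irr); rewrite ?k_gt2 //.
  - by rewrite -def_c rot_ucycle.
  - by rewrite -def_c size_rot.
  move: deg_y; rewrite -(prev_rot i Uc) def_c prev_nth mem_head.
  by rewrite (memNindex (proj1 (andP Uys))) -last_nth.
move/hasPn=> low; move: many_edges; rewrite ltnNge => /negP[].
have sum_prev : \sum_(y <- c) rel_degree e (prev c y) = \sum_(y <- c) rel_degree e y.
  by rewrite -(sum_next _ Uc); apply: eq_bigr => y _; rewrite prev_next.
rewrite mul2n -addnn (sum_spanning_seq _ Uc size_c) -{1}sum_prev.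
rewrite -big_split /= -mulnn -{2}size_c -sum1_size big_distrr /= big_seq [leqRHS]big_seq.
by apply: leq_sum => y cy; rewrite muln1 addnC leqNgt low.
Qed.

End Hamiltonicity.

(** * Cycles of a length for which no chord exists *)

Section NoChordedCycle.
Variables (G : sgraph) (k : nat).
Hypothesis no_chorded : forall c : seq G, is_cycle c -> size c = k -> ~ has_chord c.
Variable c : seq G.
Hypotheses (cyc_c : is_cycle c) (size_c : size c = k).

Let C : {set G} := [set x in c].
Let Uc : uniq c := ucycle_uniq (proj1 cyc_c).

Lemma card_cycle_set : #|C| = k.
Proof. by rewrite /C cardsE (card_uniqP Uc). Qed.

Lemma arcs_chordless : arcs C C <= k * 2.
Proof.
rewrite -{1}card_cycle_set; apply: arcs_le_mul => x; rewrite inE => cx.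
apply: (@leq_trans #|[set next c x; prev c x]|); last by rewrite cards2; case: eqP.
rewrite nbrs_in_card subset_leq_card //; apply/subsetP=> y; rewrite !inE => /andP[cy xy].
apply/negPn/negP; rewrite negb_or => /andP[ne_next ne_prev].
by apply: (no_chorded cyc_c size_c); exists x, y.
Qed.

Lemma rot_is_cycle i : is_cycle (rot i c).
Proof. by case: cyc_c => Hc le3; split; rewrite ?rot_ucycle ?size_rot. Qed.

(** A vertex [v] adjacent to [x] and to the second vertex after [x] can take
    the place of the vertex between them, and has then no further neighbour
    on the new cycle. *)
Lemma swap_nbrs v x w : 3 < k -> v \notin c -> x \in c ->
  adj v x -> adj v (next c (next c x)) -> w \in c ->
  adj v w -> w \in [set x; next c x; next c (next c x)].
Proof.
move=> k_gt3 ncv cx; have [i s def_c] := rot_to cx.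
have [/andP[]] := rot_is_cycle i; rewrite def_c -!(next_rot i Uc) def_c.
have size_s : size (x :: s) = k by rewrite -def_c size_rot.
rewrite -[w \in c](mem_rot i) -(mem_rot i) def_c in ncv *.
case: s => [|y [|z s]] in def_c size_s ncv *; rewrite -?size_s // => cyc Us _.
have [ne_yx ne_zx ne_zy] : [/\ (y == x) = false, (z == x) = false & (z == y) = false].
  by move: Us; rewrite /= !inE !negb_or => /and3P[/and3P[? ? _] /andP[? _] _]; split;
     apply: negbTE; rewrite // eq_sym.
rewrite /= !eqxx ne_yx /= => vx vz xyzs_w vw.
apply/negPn/negP; rewrite !inE !negb_or -andbA => /and3P[ne_wx ne_wy ne_wz].
have ne_vx : (v == x) = false by apply: contraNF ncv => /eqP->; rewrite mem_head.
have cyc' : is_cycle (x :: v :: z :: s).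
  split=> //; apply/andP; split.
    by move: cyc; rewrite /= => /and3P[_ _ ->]; rewrite adj_sym vx vz.
  move: Us ncv; rewrite /= !inE !negb_or => /and4P[/and3P[_ ? ?] _ ? ?] /and4P[? _ ? ?].
  by rewrite [x == v]eq_sym; do ![apply/andP; split].
apply: (no_chorded cyc') => //; exists v, w; split=> //.
- by rewrite !inE eqxx orbT.
- by move: xyzs_w; rewrite !inE (negPf ne_wx) (negPf ne_wy) /= => ->; rewrite orbT.
- by rewrite /= ne_vx eqxx.
by rewrite /= eqxx.
Qed.

(** On a 4-cycle the roles of the two opposite pairs can be exchanged. *)
Lemma swap_nbrs4 v x : k = 4 -> v \notin c -> x \in c ->
  adj v x -> adj v (next c (next c x)) -> ~~ adj v (next c x).
Proof.
move=> k4 ncv cx; have [i s def_c] := rot_to cx.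
have [/andP[]] := rot_is_cycle i; rewrite def_c -!(next_rot i Uc) def_c.
have : size (x :: s) = k by rewrite -def_c size_rot.
rewrite -(mem_rot i) def_c in ncv *; rewrite k4.
case: s => [|y [|z [|t [|? ?]]]] // in def_c ncv * => _ cyc Us _.
move: Us ncv; rewrite /= !inE !negb_or !andbT.
case/and3P=> /and3P[ne_xy ne_xz ne_xt] /andP[ne_yz ne_yt] ne_zt.
case/and4P=> ne_vx ne_vy ne_vz _.
rewrite /= !eqxx eq_sym (negPf ne_xy) => vx vz; apply/negP=> vy.
have cyc' : is_cycle [:: x; y; z; v].
  split=> //; apply/andP; split.
    by move: cyc; rewrite /= !andbT => /and4P[-> -> _ _]; rewrite adj_sym vz vx.
  by rewrite /= !inE !negb_or ![_ == v]eq_sym ne_xy ne_xz ne_yz ne_vx ne_vy ne_vz.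
apply: (no_chorded cyc') => //; exists v, y; split=> //; rewrite ?inE ?eqxx ?orbT //=.
- by rewrite (negPf ne_vx) (negPf ne_vy) (negPf ne_vz) eqxx eq_sym.
by rewrite (negPf ne_vx) (negPf ne_vy) (negPf ne_vz) eqxx.
Qed.

(** Two vertices joined to the same three consecutive vertices of a 5-cycle
    make a chorded 5-cycle with them. *)
Lemma common_triple5 u v x : k = 5 -> u \notin c -> v \notin c -> x \in c ->
  [/\ adj u x, adj u (next c x) & adj u (next c (next c x))] ->
  [/\ adj v x, adj v (next c x) & adj v (next c (next c x))] -> u = v.
Proof.
move=> k5 ncu ncv cx; have [i s def_c] := rot_to cx.
have [/andP[]] := rot_is_cycle i; rewrite def_c -!(next_rot i Uc) def_c.
have : size (x :: s) = k by rewrite -def_c size_rot.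
rewrite -!(mem_rot i c) def_c in ncu ncv *; rewrite k5.
case: s => [|y [|z [|t [|t' [|? ?]]]]] // in def_c ncu ncv * => _ cyc Us _.
move: Us ncu ncv; rewrite /= !inE !negb_or !andbT.
case/and4P=> /and4P[ne_xy ne_xz _ _] /and3P[ne_yz _ _] _ _.
case/and5P=> ne_ux ne_uy ne_uz _ _ /and5P[ne_vx ne_vy ne_vz _ _].
rewrite /= !eqxx [y == x]eq_sym (negPf ne_xy) => -[ux uy uz] [vx vy vz].
apply/eqP/negPn/negP=> ne_uv.
have cyc' : is_cycle [:: u; x; v; z; y].
  split=> //; apply/andP; split.
    move: cyc; rewrite /= => /and3P[_ yz _].
    by rewrite /= ux [adj x v]adj_sym vx vz [adj z y]adj_sym yz [adj y u]adj_sym uy.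
  rewrite /= !inE !negb_or ne_ux ne_uv ne_uy ne_uz ne_xy ne_xz ne_vy ne_vz.
  by rewrite !andbT /= eq_sym ne_vx eq_sym.
apply: (no_chorded cyc') => //; exists v, y; split=> //; rewrite ?inE ?eqxx ?orbT //=.
- by rewrite ![v == _]eq_sym (negPf ne_uv) [x == v]eq_sym (negPf ne_vx) eqxx.
by rewrite [v == u]eq_sym (negPf ne_uv) (negPf ne_vx) eqxx eq_sym.
Qed.

Lemma nbrs_in_cycle v : nbrs_in C v = \sum_(x <- c) adj v x.
Proof. by rewrite [RHS]big_uniq //; apply: eq_bigl => x; rewrite inE. Qed.

(** Shifting by two along the cycle maps the neighbours of [v] to vertices not
    adjacent to [v]. *)
Lemma sparse_nbrs v : ~~ has (fun x => adj v x && adj v (next c (next c x))) c ->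
  2 * nbrs_in C v <= k.
Proof.
move=> /hasPn far; rewrite mul2n -addnn nbrs_in_cycle.
have sum_next2 :
    \sum_(x <- c) adj v (next c (next c x)) = \sum_(x <- c) adj v x.
  by rewrite -[RHS](sum_next _ Uc) -[RHS](sum_next _ Uc).
rewrite -{2}sum_next2 -big_split /= -size_c -sum1_size big_seq [leqRHS]big_seq.
by apply: leq_sum => x /far; case: (adj v x); case: (adj v _).
Qed.

(** The three candidates left by the exchange are the whole neighbourhood on the
    cycle; on a 4-cycle the middle one is excluded too. *)
Lemma close_nbrs v : 3 < k -> v \notin c ->
  has (fun x => adj v x && adj v (next c (next c x))) c ->
  nbrs_in C v <= 3 - (k == 4).
Proof.
move=> k_gt3 ncv /hasP[x cx /andP[vx vz]]; rewrite nbrs_in_card.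
have near : [set w in C | adj v w] \subset [set x; next c x; next c (next c x)].
  apply/subsetP=> w; rewrite inE => /andP[]; rewrite inE => cw vw.
  exact: swap_nbrs vw.
case: eqP => [k4|_]; last first.
  apply: leq_trans (subset_leq_card near) _.
  by rewrite -!setUA !cardsU1 cards1; do !case: (_ \notin _).
apply: (@leq_trans #|[set x; next c (next c x)]|); last by rewrite cards2; case: eqP.
apply/subset_leq_card/subsetP=> w vw; move/subsetP/(_ _ vw): near.
rewrite !inE => /orP[/orP[->|/eqP def_w]|->]; rewrite ?orbT //.
by move: vw; rewrite inE def_w (negPf (swap_nbrs4 k4 ncv cx vx vz)) andbF.
Qed.

Lemma nbrs_in_cycle_half v : 3 < k -> k != 5 -> v \notin c -> 2 * nbrs_in C v <= k.
Proof.
move=> k_gt3 k_ne5 ncv.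
case: (boolP (has (fun x => adj v x && adj v (next c (next c x))) c)).
  by move/(close_nbrs k_gt3 ncv); case: eqP; lia.
exact: sparse_nbrs.
Qed.

Lemma nbrs_in_cycle5 v : k = 5 -> v \notin c -> nbrs_in C v <= 3.
Proof.
move=> k5 ncv.
case: (boolP (has (fun x => adj v x && adj v (next c (next c x))) c)).
  by move/close_nbrs; rewrite k5 => /(_ isT ncv).
by move/sparse_nbrs; lia.
Qed.

(** A vertex with three neighbours on a 5-cycle is joined to a consecutive
    triple. *)
Lemma nbrs_in_cycle5_triple v : k = 5 -> v \notin c ->
  nbrs_in C v <= 2 + \sum_(x <- c)
    [&& adj v x, adj v (next c x) & adj v (next c (next c x))].
Proof.
move=> k5 ncv.
case: (boolP (has (fun x => adj v x && adj v (next c (next c x))) c)); last first.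
  by move/sparse_nbrs; lia.
case/hasP=> x cx /andP[vx vz].
rewrite (big_rem x) //= vx vz andbT; case: (boolP (adj v (next c x))) => [_|nvy].
  by have := nbrs_in_cycle5 k5 ncv; lia.
apply: leq_trans (leq_addr _ _); rewrite nbrs_in_card.
apply: (@leq_trans #|[set x; next c (next c x)]|); last by rewrite cards2; case: eqP.
apply/subset_leq_card/subsetP=> w; rewrite inE => /andP[]; rewrite inE => cw vw.
have := swap_nbrs _ ncv cx vx vz cw vw; rewrite k5 => /(_ isT).
rewrite !inE => /orP[/orP[->|/eqP def_w]|->]; rewrite ?orbT //.
by rewrite -def_w vw in nvy.
Qed.

(** Each of the five consecutive triples accounts for one vertex with a third
    neighbour. *)
Lemma arcs_out_cycle5 : k = 5 -> arcs (~: C) C <= 2 * #|~: C| + 5.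
Proof.
move=> k5; apply: (@leq_trans (\sum_(v in ~: C) (2 + \sum_(x <- c)
    [&& adj v x, adj v (next c x) & adj v (next c (next c x))]))).
  by apply: leq_sum => v; rewrite !inE; apply: nbrs_in_cycle5_triple.
rewrite big_split /= sum_nat_const mulnC leq_add2l exchange_big /=.
rewrite -[leqRHS]k5 -size_c -sum1_size big_seq [leqRHS]big_seq.
apply: leq_sum => x cx.
pose t v := [&& adj v x, adj v (next c x) & adj v (next c (next c x))].
have -> : \sum_(v in ~: C) t v = #|[set v in ~: C | t v]|.
  rewrite -sum1_card big_mkcond [RHS]big_mkcond.
  by apply: eq_bigr => v _; rewrite [in RHS]inE; case: (v \in ~: C); case: (t v).
apply/card_le1_eqP=> u v; rewrite !inE => /andP[ncu /and3P[? ? ?]] /andP[ncv /and3P[? ? ?]].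
by apply: (common_triple5 k5 ncv ncu cx).
Qed.

End NoChordedCycle.

(** * Numerical comparisons with the Turan number *)

Lemma turan_size2 n : turan_size 2 n = (1 * n ^ 2) %/ 4.
Proof. exact: turan_size_floor. Qed.

Lemma turan_size3 n : turan_size 3 n = (2 * n ^ 2) %/ 6.
Proof. exact: turan_size_floor. Qed.

Lemma turan_size4 n : turan_size 4 n = (3 * n ^ 2) %/ 8.
Proof. exact: turan_size_floor. Qed.

Lemma turan_size5 n : turan_size 5 n = (4 * n ^ 2) %/ 10.
Proof. exact: turan_size_floor. Qed.

Lemma divn_le_trans d a b x y :
  0 < d -> d * a + x <= y + d * b -> a + x %/ d <= y %/ d + b.
Proof.
move=> d_gt0 /(leq_div2r d).
by rewrite mulnC divnMDl // [y + _]addnC mulnC divnMDl // [b + _]addnC.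
Qed.

(** For [r = 3] the two sides differ, up to rounding, by a multiple of
    [(k - 1) * (n - 2 k - 2)]. *)
Lemma low_degree_bound r n k : 2 < r -> 0 < k -> 2 * k + 2 <= n ->
  k ^ 2 + turan_size r (n - k) <= turan_size r (n - 1) + 1.
Proof.
move=> r_gt2 k_gt0 le_kn.
have le_m : n - k <= n - 1 by lia.
have := turan_size_diff_mono (isT : 0 < 3) r_gt2 le_m.
suff : k ^ 2 + turan_size 3 (n - k) <= turan_size 3 (n - 1) + 1 by lia.
rewrite !turan_size3.
have [j def_k] : exists j, k = j.+1 by exists k.-1; lia.
subst k.
have [d def_n] : exists d, n = 2 * j.+1 + 2 + d by exists (n - (2 * j.+1 + 2)); lia.
have -> : n - j.+1 = j + 3 + d by lia.
have -> : n - 1 = 2 * j + 3 + d by lia.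
apply: divn_le_trans => //.
by rewrite -!mulnn; nia.
Qed.

(** The case [n = 2 k + 1]. For [r = 4] and [k = 5], as for [r = 5] and
    [k = 3], both sides are equal. *)
Lemma low_degree_bound_half r k : 3 < r -> 0 < k -> (r == 4 -> 4 < k) ->
  k ^ 2 + turan_size r k.+1 <= turan_size r (2 * k) + 1.
Proof.
move=> r_gt3 k_gt0 r4; have le_m : k.+1 <= 2 * k by lia.
case: eqP r4 => [-> /(_ isT) k_gt4|/eqP r_ne4 _].
  rewrite !turan_size4.
  have [j ->] : exists j, k = j + 5 by exists (k - 5); lia.
  apply: divn_le_trans => //.
  by rewrite -!mulnn; nia.
have r_ge5 : 5 <= r by lia.
have := turan_size_diff_mono (isT : 0 < 5) r_ge5 le_m.
suff : k ^ 2 + turan_size 5 k.+1 <= turan_size 5 (2 * k) + 1 by lia.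
rewrite !turan_size5; case: k k_gt0 {le_m} => // -[|[|j]] _ //.
apply: divn_le_trans => //.
by rewrite -!mulnn; nia.
Qed.

(** For [k = 5] this fails for large [n] when [5 (n - 5) / 2] is raised to
    [3 (n - 5)], the bound that holds for outside vertices of a 5-cycle. *)
Lemma cycle_bound r n k : 2 < r -> 3 < k < n -> k != 5 ->
  2 * k + k * (n - k) + 2 * turan_size r (n - k) < 2 * turan_size r (n - 1) + 4.
Proof.
move=> r_gt2 /andP[k_gt3 lt_kn] k_ne5; have le_m : n - k <= n - 1 by lia.
have := turan_size_diff_mono (isT : 0 < 3) r_gt2 le_m.
suff : 2 * k + k * (n - k) + 2 * turan_size 3 (n - k) <
       2 * turan_size 3 (n - 1) + 4 by lia.
rewrite !turan_size3.
have [d def_n] : exists d, n = k + d by exists (n - k); lia.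
have -> : n - k = d by lia.
have -> : n - 1 = k.-1 + d by lia.
have [k4|[j def_k]] : k = 4 \/ exists j, k = j + 6.
- by case: (k =P 4) => [|?]; [left | right; exists (k - 6); lia].
- have -> : k.-1 = 3 by lia.
  have -> : 2 * (3 + d) ^ 2 = 2 * d ^ 2 + 6 * (2 * d + 3) by rewrite -!mulnn; lia.
  by rewrite k4; lia.
have -> : k.-1 = j + 5 by lia.
suff : 3 * (2 * k + k * d) + 2 * d ^ 2 <= 2 * (j + 5 + d) ^ 2 + 6 by lia.
by rewrite def_k -!mulnn; nia.
Qed.

Lemma cycle5_bound r n : 3 < r -> 5 < n ->
  10 + 6 * (n - 5) + 2 * turan_size r (n - 5) < 2 * turan_size r (n - 1) + 4.
Proof.
move=> r_gt3 lt_n; have le_m : n - 5 <= n - 1 by lia.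
have := turan_size_diff_mono (isT : 0 < 4) r_gt3 le_m.
have -> : n - 1 = n - 5 + 4 by lia.
by have := turan_size_addr (n - 5) (isT : 0 < 4); lia.
Qed.

Lemma cycle5_bound3 n : 9 < n ->
  10 + 2 * (2 * (n - 5) + 5) + 2 * turan_size 3 (n - 5) <
  2 * turan_size 3 (n - 1) + 4.
Proof.
move=> lt_n; have [d ->] : exists d, n = d + 10 by exists (n - 10); lia.
have -> : d + 10 - 5 = d + 5 by lia.
have -> : d + 10 - 1 = d + 9 by lia.
by rewrite !turan_size3 -!mulnn; case: d => [|d] //; lia.
Qed.

(** The hypothesis of Bondy's theorem. *)
Lemma turan_size_quarter r n : 2 < r -> 0 < n ->
  n ^ 2 < 4 * turan_size r (n - 1) + 8.
Proof.
move=> r_gt2 n_gt0; have := turan_size_mono (n - 1) (isT : 0 < 3) r_gt2.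
suff : n ^ 2 < 4 * turan_size 3 (n - 1) + 8 by lia.
rewrite turan_size3; have [m ->] : exists m, n = m.+1 by exists n.-1; lia.
rewrite subn1 /= -!mulnn.
suff : 3 * (m.+1 * m.+1) <= 4 * (m * m) + 13 by lia.
by case: m => [|[|[|m]]]; nia.
Qed.

(** * Dense clique-free graphs are chorded pancyclic *)

Lemma exists_subset_card (T : finType) (A : {set T}) k :
  k <= #|A| -> exists2 S : {set T}, S \subset A & #|S| = k.
Proof.
move=> le_kA; exists [set x in take k (enum A)].
  by apply/subsetP=> x; rewrite inE => /mem_take; rewrite mem_enum.
by rewrite cardsE (card_uniqP (take_uniq _ (enum_uniq A))) size_takel // -cardE.
Qed.

Section DenseGraph.
Variable G : sgraph.
Implicit Types (A B S : {set G}).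

Lemma rel_degree_adj (x : G) : rel_degree (@adj G) x = nbrs_in [set: G] x.
Proof. by rewrite /nbrs_in; apply: eq_bigl => y; rewrite inE. Qed.

Lemma arcs_setT_split S :
  arcs [set: G] [set: G] = arcs S S + 2 * arcs S (~: S) + arcs (~: S) (~: S).
Proof. by rewrite (arcs_diag_split (subsetT S)) setTD (arcs_sym S). Qed.

Lemma arcs_low_degree S k : {in S, forall x, nbrs_in [set: G] x <= k} ->
  arcs [set: G] [set: G] <= 2 * (#|S| * k) + arcs (~: S) (~: S).
Proof.
move=> low; have := arcs_le_mul low.
by rewrite (arcs_setT_split S) (arcs_splitr [set: G] S) setTI setTD; lia.
Qed.

(** A vertex with [d] neighbours in [B] makes [B] sparse: these neighbours
    span no [K_r]. *)
Lemma arcs_nbrs_bound r B x : 1 < r -> K_free r.+1 G ->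
  arcs B B <= 2 * turan_size r.-1 (nbrs_in B x) +
              2 * ((#|B| - nbrs_in B x) * #|B|.-1).
Proof.
move=> r_gt1 Kfree; pose N := [set y in B | adj x y].
have sNB : N \subset B by apply/subsetP=> y; rewrite inE => /andP[].
have cardN : #|N| = nbrs_in B x by rewrite nbrs_in_card.
have cardBN : #|B :\: N| = #|B| - nbrs_in B x.
  by rewrite cardsD (setIidPr sNB) cardN.
have inN : arcs N N <= 2 * turan_size r.-1 #|N|.
  apply: turan_bound; first by lia.
  by rewrite prednK; [apply: nbrs_clique_free | lia].
have outN : arcs (B :\: N) B <= #|B :\: N| * #|B|.-1.
  by apply: arcs_le_mul => y /setDP[By _]; have := nbrs_in_lt By; lia.
rewrite (arcs_diag_split sNB); rewrite (arcs_splitr B N) (setIidPr sNB) in outN.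
by move: inN outN; rewrite cardN cardBN; lia.
Qed.

(** Here [k ^ 2 + t 3 (k + 1)] is too large by a linear term. If some vertex of
    [S] has [k] or [k - 1] neighbours in the complement of [S], a set of
    [k + 1] vertices, then this complement is triangle-free up to one or two
    vertices. Otherwise all vertices of [S] have at most [k - 2] neighbours
    outside [S], and the edges inside [S], having two ends in [S], save [k]
    edges. *)
Lemma low_degree_half3 S k : 13 <= k -> K_free 4 G -> #|G| = (2 * k).+1 ->
  #|S| = k -> {in S, forall x, nbrs_in [set: G] x <= k} ->
  arcs [set: G] [set: G] <= 2 * turan_size 3 (2 * k) + 2.
Proof.
move=> k_ge12 Kfree card_G card_S low.
have card_B : #|~: S| = k.+1 by have := cardsC S; rewrite card_S card_G; lia.
have splitS x : nbrs_in [set: G] x = nbrs_in S x + nbrs_in (~: S) x.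
  by rewrite (nbrs_in_split _ S) setTI setTD.
have count m : {in S, forall x, nbrs_in S x + 2 * nbrs_in (~: S) x <= m} ->
    arcs S S + 2 * arcs S (~: S) <= k * m.
  move=> le_m; rewrite /arcs big_distrr -big_split /= -card_S -sum_nat_const.
  exact: leq_sum.
have t3_lo : 8 * k ^ 2 <= 6 * turan_size 3 (2 * k) + 5.
  by rewrite turan_size3 expnMn; lia.
have t2_up m : 4 * turan_size 2 m <= m ^ 2 by rewrite turan_size2; lia.
rewrite (arcs_setT_split S).
case: (boolP [exists x in S, nbrs_in (~: S) x == k]) => [/exists_inP[x Sx /eqP d_x]|].
  have {}count : arcs S S + 2 * arcs S (~: S) <= k * (2 * k).
    by apply: count => y /low; rewrite splitS; lia.
  have := arcs_nbrs_bound (~: S) x (isT : 1 < 3) Kfree; rewrite card_B d_x /=.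
  by have := t2_up k; rewrite -!mulnn in t3_lo *; nia.
rewrite negb_exists_in => /forall_inP not_k.
case: (boolP [exists x in S, nbrs_in (~: S) x == k.-1]) => [/exists_inP[x Sx /eqP d_x]|].
  have {}count : arcs S S + 2 * arcs S (~: S) <= k * (2 * k - 1).
    by apply: count => y Sy; have := low y Sy; have := not_k y Sy; rewrite splitS; lia.
  have := arcs_nbrs_bound (~: S) x (isT : 1 < 3) Kfree; rewrite card_B d_x /=.
  have := t2_up k.-1; have [j def_k] : exists j, k = j + 13 by exists (k - 13); lia.
  have -> : k.-1 = j + 12 by lia.
  have -> : k.+1 - (j + 12) = 2 by lia.
  rewrite def_k in t3_lo count *; have : 2 * (j + 13) - 1 = 2 * j + 25 by lia.
  by move=> eq_j; rewrite eq_j -!mulnn in t3_lo count *; nia.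
rewrite negb_exists_in => /forall_inP not_k1.
have {}count : arcs S S + 2 * arcs S (~: S) <= k * (2 * k - 2).
  apply: count => y Sy; have := low y Sy; rewrite splitS.
  by have := not_k y Sy; have := not_k1 y Sy; lia.
have := turan_bound (isT : 0 < 3) (K_free_has_clique_in (~: S) Kfree).
have : 6 * turan_size 3 k.+1 <= 2 * k.+1 ^ 2 by rewrite turan_size3; lia.
rewrite card_B; have [j def_k] : exists j, k = j.+1 by exists k.-1; lia.
rewrite def_k in t3_lo count *; have eq_j : 2 * j.+1 - 2 = 2 * j by lia.
by rewrite eq_j -!mulnn in t3_lo count *; nia.
Qed.

(** A non-Hamiltonian graph has [k < n / 2] vertices of degree at most [k], so
    at most [k ^ 2] edges outside a [K_(r+1)]-free graph on [n - k] vertices. *)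
Lemma dense_hamiltonian r : 2 < r -> K_free r.+1 G ->
  (if r == 3 then 26 else if r == 4 then 11 else 4) <= #|G| ->
  2 * turan_size r (#|G| - 1) + 4 <= arcs [set: G] [set: G] ->
  hamiltonian (@adj G).
Proof.
move=> r_gt2 Kfree large dense.
have n_gt3 : 3 < #|G| by move: large; case: ifP => _; [|case: ifP => _]; lia.
apply: (posa (@adj_sym G) (@adj_irrefl G)); first by lia.
move=> k k_gt0 lt_kn; rewrite ltnNge; apply/negP=> /exists_subset_card[S sS card_S].
have low : {in S, forall x, nbrs_in [set: G] x <= k}.
  by move=> x /(subsetP sS); rewrite inE rel_degree_adj.
have card_B : #|~: S| = #|G| - k by have := cardsC S; rewrite card_S; lia.
have := turan_bound (ltnW (ltnW r_gt2)) (K_free_has_clique_in (~: S) Kfree).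
have := arcs_low_degree low; rewrite card_B card_S mulnn.
case: (leqP (2 * k + 2) #|G|) => [le_kn|ge_kn].
  by have := low_degree_bound r_gt2 k_gt0 le_kn; lia.
have card_G : #|G| = (2 * k).+1 by lia.
have [r3|r_ne3] := eqVneq r 3.
  subst r; have := low_degree_half3 _ Kfree card_G card_S low.
  by move: dense large; rewrite card_G subn1 /=; lia.
have r_gt3 : 3 < r by lia.
have r4 : r == 4 -> 4 < k.
  by move=> r4; move: large; rewrite (negPf r_ne3) r4 card_G; lia.
have := low_degree_bound_half r_gt3 k_gt0 r4.
move: dense; rewrite card_G subn1 /=.
have -> : (2 * k).+1 - k = k.+1 by lia.
by lia.
Qed.

(** If no [k]-cycle has a chord, then a vertex outside a [k]-cycle has at most
    about [k / 2] neighbours on it, too few for a graph with so many edges. *)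
Lemma dense_chorded_cycle r k : 2 < r -> K_free r.+1 G ->
  (if r == 3 then 26 else if r == 4 then 11 else 4) <= #|G| ->
  2 * turan_size r (#|G| - 1) + 4 <= arcs [set: G] [set: G] ->
  3 < k <= #|G| -> hamiltonian (@adj G) ->
  exists c : seq G, [/\ is_cycle c, size c = k & has_chord c].
Proof.
move=> r_gt2 Kfree large dense k_range ham.
have [c [cyc_c size_c]] : exists c : seq G, ucycle (@adj G) c /\ size c = k.
  apply: (bondy (@adj_sym G) (@adj_irrefl G) ham); first by lia.
  have -> : \sum_x rel_degree (@adj G) x = arcs [set: G] [set: G].
    rewrite /arcs [RHS](eq_bigl xpredT) => [|x]; last by rewrite inE.
    by apply: eq_bigr => x _; apply: rel_degree_adj.
  by have := @turan_size_quarter r #|G| r_gt2; lia.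
case: (boolP [exists p : k.-tuple G, ucycleb (@adj G) p &&
    [exists x in p, exists y in p, [&& adj x y, y != next p x & y != prev p x]]]).
  case/existsP=> p /andP[cyc_p /exists_inP[x px /exists_inP[y py /and3P[xy ne_next ne_prev]]]].
  exists p; rewrite size_tuple; split=> //; last by exists x, y.
  by split; rewrite ?size_tuple //; lia.
move=> none; have no_chorded : forall p : seq G, is_cycle p -> size p = k -> ~ has_chord p.
  move=> p [cyc_p _] /eqP size_p [x [y [px py xy ne_next ne_prev]]].
  case/existsP: none; exists (Tuple size_p); rewrite [ucycleb _ _]cyc_p /=.
  apply/exists_inP; exists x => //; apply/exists_inP; exists y => //.
  by rewrite xy ne_next.
have cyc : is_cycle c by split=> //; lia.
pose C := [set x in c].
have card_C : #|C| = k by apply: card_cycle_set cyc size_c.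
have card_B : #|~: C| = #|G| - k by have := cardsC C; rewrite card_C; lia.
have inC := arcs_chordless no_chorded cyc size_c.
case/andP: (k_range) => k_gt3; rewrite leq_eqVlt => /orP[/eqP k_n|lt_kn].
  have CT : C = [set: G] by apply/eqP; rewrite eqEcard subsetT cardsT card_C k_n leqnn.
  move: inC; rewrite -/C CT => le_arcs.
  have := @turan_size_quarter r #|G| r_gt2; rewrite -mulnn.
  by move: dense le_arcs k_gt3; rewrite -k_n; nia.
have := turan_bound (ltnW (ltnW r_gt2)) (K_free_has_clique_in (~: C) Kfree).
move: dense; rewrite (arcs_setT_split C) (arcs_sym C (~: C)) card_B -/C in inC *.
have [k5|k_ne5] := eqVneq k 5; last first.
  have half : 2 * arcs (~: C) C <= k * (#|G| - k).
    rewrite /arcs big_distrr -card_B mulnC -sum_nat_const; apply: leq_sum => v.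
    rewrite !inE => ncv; apply: (nbrs_in_cycle_half no_chorded cyc size_c) => //.
  by have := @cycle_bound r #|G| k r_gt2 _ k_ne5; rewrite k_gt3 lt_kn => /(_ isT); lia.
have [r3|r_ne3] := eqVneq r 3.
  subst r; have := arcs_out_cycle5 no_chorded cyc size_c k5.
  rewrite -/C card_B k5; have : 9 < #|G| by move: large => /=; lia.
  by move/cycle5_bound3; lia.
have le3 : {in ~: C, forall v, nbrs_in C v <= 3}.
  by move=> v; rewrite !inE; apply: (nbrs_in_cycle5 no_chorded cyc size_c k5).
have := arcs_le_mul le3; rewrite card_B k5.
have r_gt3 : 3 < r by lia.
have n_gt5 : 5 < #|G| by rewrite -k5.
by have := cycle5_bound r_gt3 n_gt5; lia.
Qed.

End DenseGraph.

(** * The Turan graph with a pendant vertex *)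

Lemma graph_iso_num_edges (G H : sgraph) : graph_iso G H -> num_edges G = num_edges H.
Proof.
case=> f [f_bij f_adj]; apply/eqP; rewrite -(eqn_pmul2l (ltn0Sn 1)) !double_num_edges.
rewrite /arcs (reindex f) /=; last exact: onW_bij.
apply/eqP; apply: eq_big => [x|x _]; first by rewrite !inE.
rewrite /nbrs_in [RHS](reindex f) /=; last exact: onW_bij.
by apply: eq_big => y; rewrite ?inE // f_adj.
Qed.

Lemma sum_del_vertex (G : sgraph) (v : G) (F : G -> nat) :
  \sum_(u in [set: del_vertex v]) F (val u) = \sum_(x in ~: [set v]) F x.
Proof.
rewrite [RHS](reindex_omap (val : {x | x != v} -> G) insub) /=.
  by apply: eq_bigl => u; rewrite !inE valK eqxx (valP u).
by move=> x; rewrite !inE => ne_xv; rewrite insubT.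
Qed.

Lemma num_edges_del_vertex (G : sgraph) (v : G) :
  num_edges G = num_edges (del_vertex v) + degree v.
Proof.
apply/eqP; rewrite -(eqn_pmul2l (ltn0Sn 1)) mulnDr !double_num_edges.
have -> : arcs [set: del_vertex v] [set: del_vertex v] = arcs (~: [set v]) (~: [set v]).
  rewrite /arcs -sum_del_vertex; apply: eq_bigr => u _.
  by rewrite /nbrs_in -sum_del_vertex.
rewrite (arcs_setT_split [set v]) degree_nbrs_in (nbrs_in_split _ [set v]) setTI setTD.
by rewrite /arcs !big_set1 /nbrs_in !big_set1 adj_irrefl; apply/eqP; lia.
Qed.

Lemma turan_K_free r n : 0 < r -> K_free r.+1 (turan r n).
Proof.
move=> r_gt0 [A [clA card_A]].
pose part (x : turan r n) := Ordinal (ltn_pmod x r_gt0).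
suff part_inj : {in A &, injective part}.
  have := subset_leq_card (subsetT (part @: A)).
  by rewrite card_in_imset // card_A cardsT card_ord ltnn.
move=> x y Ax Ay [eq_xy]; apply/eqP/negPn/negP=> /(clA x y Ax Ay).
by rewrite /= /turan_adj eq_xy eqxx.
Qed.

Lemma graph_iso_K_free (G H : sgraph) k : graph_iso G H -> K_free k H -> K_free k G.
Proof.
case=> f [f_bij f_adj] Kfree [A [clA card_A]]; apply: Kfree.
exists (f @: A); split; last by rewrite card_imset //; apply: bij_inj.
move=> _ _ /imsetP[x Ax ->] /imsetP[y Ay ->] ne_xy; rewrite f_adj; apply: clA => //.
by apply: contraNneq ne_xy => ->.
Qed.

(** A clique through [v] has at most [degree v + 1] vertices. *)
Lemma del_vertex_K_free (G : sgraph) (v : G) k :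
  (degree v).+1 < k -> K_free k (del_vertex v) -> K_free k G.
Proof.
move=> deg_v Kfree [A [clA card_A]].
case: (boolP (v \in A)) => [Av|nAv].
  have : #|A :\ v| <= degree v.
    apply/subset_leq_card/subsetP=> x; rewrite !inE => /andP[ne_xv Ax].
    by rewrite clA // eq_sym.
  by have := cardsD1 v A; rewrite Av card_A; lia.
apply: Kfree; exists [set u : del_vertex v | val u \in A]; split.
  move=> x y; rewrite !inE => Ax Ay ne_xy; apply: (clA _ _ Ax Ay).
  by rewrite (inj_eq val_inj).
rewrite -card_A -(card_imset _ val_inj); apply: eq_card => x.
apply/imsetP/idP=> [[u]|Ax]; first by rewrite inE => Au ->.
have ne_xv : x != v by apply: contraNneq nAv => <-.
by exists (Sub x ne_xv); rewrite ?inE SubK.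
Qed.

Lemma cycle_degree (G : sgraph) (c : seq G) x : is_cycle c -> x \in c -> 1 < degree x.
Proof.
case=> /andP[cyc Uc] size_c cx.
have ne_np : next c x != prev c x.
  have [i s def_c] := rot_to cx.
  rewrite -(next_rot i Uc) -(prev_rot i Uc) def_c.
  have : 2 < size (x :: s) by rewrite -def_c size_rot.
  have : uniq (x :: s) by rewrite -def_c rot_uniq.
  rewrite prev_nth mem_head => Us; rewrite (memNindex (proj1 (andP Us))) -last_nth.
  case: s {def_c} Us => [|y [|z s]] //= /and3P[_ nsy _] _; rewrite eqxx.
  by apply: contraNneq nsy => ->; apply: mem_last.
have -> : 2 = #|[set next c x; prev c x]| by rewrite cards2 ne_np.
apply/subset_leq_card/subsetP=> y; rewrite !inE => /orP[]/eqP->.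
  exact: next_cycle.
by rewrite adj_sym; apply: prev_cycle.
Qed.

Theorem corollary5p9 (r n : nat) (G : sgraph) (hr : 3 <= r) (hn : #|G| = n)
    (hnr : (if r == 3 then 26 else if r == 4 then 11 else 4) <= n) :
  (K_free r.+1 G -> ~ chorded_pancyclic G ->
     num_edges G <= num_edges (turan r (n - 1)) + 1) /\
  (turan_plus_pendant r (n - 1) G ->
     [/\ K_free r.+1 G, ~ chorded_pancyclic G &
         num_edges G = num_edges (turan r (n - 1)) + 1]).
Proof.
have r_gt0 : 0 < r by lia.
have n_gt3 : 3 < n by move: hnr; case: ifP => _; [|case: ifP => _]; lia.
split=> [Kfree not_cpc|[v [deg_v iso_v]]]; last first.
  split.
  - apply: (@del_vertex_K_free _ v); first by rewrite deg_v; lia.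
    exact: graph_iso_K_free iso_v (turan_K_free r_gt0).
  - move=> /(_ n); rewrite hn leqnn n_gt3 => /(_ isT)[c [cyc_c size_c _]].
    have /(cycle_degree cyc_c) : v \in c.
      by apply: spanning_seq_mem; [case: cyc_c => /andP[] | rewrite size_c].
    by rewrite deg_v.
  by rewrite (num_edges_del_vertex v) deg_v (graph_iso_num_edges iso_v).
rewrite leqNgt; apply/negP; rewrite num_edges_turan // => many_edges.
have dense : 2 * turan_size r (#|G| - 1) + 4 <= arcs [set: G] [set: G].
  by rewrite -double_num_edges hn; lia.
rewrite -hn in hnr.
have ham := dense_hamiltonian hr Kfree hnr dense.
by apply: not_cpc => k k_range; apply: (dense_chorded_cycle hr).
Qed.
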